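(* Let $\mathcal{A} \subset M_n$ be a nilpotent operator algebra. Then the minimal size of a partition of $\mathbb{C}^n$ into quantum chains for $\mathcal{A}$ is no larger than the maximal width of a quantum antichain for $\mathcal{A}$.
   Context: $M_n=M_n(\mathbb{C})$ is identified with the linear operators on the Hilbert space $\mathbb{C}^n$. An operator algebra in $M_n$ is a complex linear subspace closed under products; it is nilpotent if all its elements are nilpotent matrices. A subspace $\mathcal{E}$ is invariant for $\mathcal{A}$ if $A(\mathcal{E})\subseteq\mathcal{E}$ for all $A\in\mathcal{A}$, and semi-invariant if $\mathcal{E}=\mathcal{E}_1\cap\mathcal{E}_2^\perp$ for some invariant subspaces $\mathcal{E}_2\subseteq\mathcal{E}_1$. A quantum antichain for $\mathcal{A}$ is a nonzero semi-invariant subspace $\mathcal{E}\subseteq\mathbb{C}^n$ with $P\mathcal{A}P=\{0\}$, where $P$ is the orthogonal projection onto $\mathcal{E}$; its width is $\dim\mathcal{E}$. A quantum chain for $\mathcal{A}$ is a sequence $\mathcal{C}=(v_1,\ldots,v_k)$ of nonzero vectors in $\mathbb{C}^n$ with $v_{i+1}\in\mathcal{A}v_i=\{Av_i:A\in\mathcal{A}\}$ for $1\le i<k$. A partition into quantum chains is a family of quantum chains $\mathcal{C}_1,\ldots,\mathcal{C}_k$ for $\mathcal{A}$ whose union $\bigcup_{i=1}^k\mathcal{C}_i$ constitutes a basis of $\mathbb{C}^n$; its size is $k$. *)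

(* Defs.v *)
From HB Require Import structures.
From mathcomp Require Import all_boot all_order all_algebra.
From mathcomp Require Import sesquilinear spectral.
From mathcomp Require Import reals complex.

Set Implicit Arguments.
Unset Strict Implicit.
Unset Printing Implicit Defensive.

Import Order.TTheory GRing.Theory Num.Theory Num.Def.
Local Open Scope ring_scope.
Local Open Scope sesquilinear_scope.

(* C^n is the space 'cV[C]_n of column vectors, on which matrices act by *m. *)

Section InnerProduct.
Variables (C : numClosedFieldType) (n : nat).

(* The standard inner product \sum_i u_i * (v_i)^* (lemma cdotE); it is stated
   as \tr (u *m v ^t* ) to inherit the hermitian structure required by orthov. *)
Definition cdot (u v : 'cV[C]_n) : C := form_of_matrix conjC 1%:M u v.

HB.instance Definition _ := Hermitian.copy cdot
  (form_of_matrix conjC 1%:M : 'cV[C]_n -> 'cV[C]_n -> C).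

Lemma cdotE u v : cdot u v = \sum_i u i 0 * (v i 0)^*.
Proof.
rewrite /cdot /form_of_matrix mulmx1 /mxtrace; apply: eq_bigr => i _.
by rewrite mxE big_ord1 !mxE.
Qed.

Definition orthoc (E : {vspace 'cV[C]_n}) : {vspace 'cV[C]_n} := orthov cdot E.

Lemma orthocP (E : {vspace 'cV[C]_n}) (u : 'cV[C]_n) :
  reflect {in E, forall v, cdot u v = 0} (u \in orthoc E).
Proof. exact: mem_orthovP. Qed.

Definition is_orthoproj (P : 'M[C]_n) (E : {vspace 'cV[C]_n}) :=
  forall v : 'cV[C]_n, P *m v \in E /\ v - P *m v \in orthoc E.

End InnerProduct.

Section QuantumOrder.
Variables (C : numClosedFieldType) (n : nat).
Implicit Types (A : {vspace 'M[C]_n}) (E : {vspace 'cV[C]_n}).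

Definition is_operator_algebra A := {in A &, forall X Y, X *m Y \in A}.

Definition nilpotent_mx (X : 'M[C]_n) := exists k : nat, X ^+ k = 0.

Definition is_nilpotent_algebra A :=
  is_operator_algebra A /\ {in A, forall X, nilpotent_mx X}.

Definition invariant_subspace A E := {in A & E, forall X v, X *m v \in E}.

Definition semi_invariant A E :=
  exists E1 E2, [/\ invariant_subspace A E1, invariant_subspace A E2, (E2 <= E1)%VS
                  & E = (E1 :&: orthoc E2)%VS].

Definition quantum_antichain A E :=
  [/\ E != 0%VS, semi_invariant A E
    & exists2 P, is_orthoproj P E & {in A, forall X, P *m X *m P = 0}].

Definition quantum_chain A (c : seq 'cV[C]_n) :=
  [/\ c != [::], 0 \notin c
    & forall i, (i.+1 < size c)%N -> exists2 X, X \in A & c`_i.+1 = X *m c`_i].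

(* Being a basis, flatten p has no repetition: the chains are disjoint. *)
Definition quantum_chain_partition A (p : seq (seq 'cV[C]_n)) :=
  {in p, forall c, quantum_chain A c} /\ basis_of fullv (flatten p).

Definition is_min_partition_size A (k : nat) :=
  (exists2 p, quantum_chain_partition A p & size p = k) /\
  (forall p, quantum_chain_partition A p -> (k <= size p)%N).

Definition is_max_antichain_width A (w : nat) :=
  (exists2 E, quantum_antichain A E & \dim E = w) /\
  (forall E, quantum_antichain A E -> (\dim E <= w)%N).

End QuantumOrder.

(* Main.v *)
(* For a subspace [U] let [AU] be the span of the vectors [X u]. If antichains
   have width at most [w], then [dim U <= dim AU + w] for all [U], because
   [(U + AU) :&: (AU)^perp] is an antichain (or zero). By Rado's theorem this
   deficiency bound is what one needs to pick independent successors
   [u_i \in A v_i] for all but [w] vectors of a basis [v_i]; the difficulty is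
   that the successors must be vectors of that same basis.

   To get around it, generalize to an invariant subspace [F] with [m] slots
   [S_j], invariant subspaces of [F], where the head of the j-th chain must lie
   in [S_j], under the Rado condition
     [dim U + #|J| <= dim (AU + \sum_(j in J) S_j) + m]
   for all [U <= F] and [J]. Shrink the slots as long as the condition survives.
   Then each nonzero [S_i] is blocked by a pair [(U, J)] where equality holds,
   with [i \notin J] and [S_i <= U]. Such pairs are closed under joins by
   submodularity, and joining them shows that for some [k] the subspace
   [H = AF + \sum_(j != k) S_j] is a hyperplane of [F] missing [S_k]. Take a
   vector [h] of [S_k] outside [H] as head of the k-th chain, and replace [F]
   by [H] and [S_k] by [Ah]: applying the old condition to [U + <[h]>] gives the
   new one, so the construction goes on by induction. *)

Require Import Defs.
From mathcomp Require Import all_boot all_order all_algebra.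
From mathcomp Require Import sesquilinear boolp.
From mathcomp Require Import reals complex.
From mathcomp Require Import zify.

Set Implicit Arguments.
Unset Strict Implicit.
Unset Printing Implicit Defensive.

Import GRing.Theory Num.Theory.
Local Open Scope ring_scope.

(** * Dimension counts for subspaces *)

Section VectorSpaces.
Variables (K : fieldType) (vT : vectType K).
Implicit Types (U V W X Y : {vspace vT}) (x : vT).

(** Submodularity: the gain from adding [W] can only drop as [X] grows, because [Y :&: (X + W)]
    contains [X]. *)
Lemma dimv_add_codim X Y W : (X <= Y)%VS ->
  (\dim (Y + W) + \dim X <= \dim (X + W) + \dim Y)%N.
Proof.
move=> sXY; have := dimv_sum_cap Y (X + W)%VS.
rewrite addvA (addv_idPl sXY).
have : (X <= Y :&: (X + W))%VS by rewrite subv_cap sXY addvSl.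
by move/dimvS; lia.
Qed.

Lemma dimv_addline W x : (\dim (W + <[x]>) <= \dim W + 1)%N.
Proof.
have [+ _] := dimv_add_leqif W <[x]>; rewrite dim_vline.
by case: (x != 0); lia.
Qed.

Lemma dimv_addline_notin W x : x \notin W -> \dim (W + <[x]>) = (\dim W).+1.
Proof.
move=> xW; apply/eqP; rewrite eqn_leq -addn1 dimv_addline addn1 /=.
have /leqifP := dimv_leqif_sup (addvSl W <[x]>).
by rewrite subv_add subvv -memvE (negPf xW).
Qed.

Lemma subv_of_dim U W : (\dim (U + W) <= \dim U)%N -> (W <= U)%VS.
Proof.
move=> led; have [_ /esym] := dimv_leqif_sup (addvSl U W).
by rewrite eqn_leq led dimvS ?addvSl // subv_add => /andP[].
Qed.

Lemma exists_hyperplane U W : (U <= W)%VS -> ~~ (W <= U)%VS ->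
  exists X x, [/\ (U <= X)%VS, (X + <[x]>)%VS = W & x \notin X].
Proof.
move=> sUW /subvPn[x xW xU].
(* A complement of [U + <[x]>] in [W] supplies every direction but that of [x]. *)
pose X := (U + (W :\: (U + <[x]>)))%VS.
have sx : (U + <[x]> <= W)%VS by rewrite subv_add sUW -memvE.
have eW : (X + <[x]>)%VS = W.
  by rewrite -addvA (addvC _ <[x]>%VS) addvA addvC addv_diff; apply/addv_idPl.
exists X, x; split=> //; first exact: addvSl.
have dX : (\dim X <= \dim U + \dim (W :\: (U + <[x]>)))%N.
  by have [] := dimv_add_leqif U (W :\: (U + <[x]>))%VS.
have := dimv_cap_compl W (U + <[x]>); rewrite (capv_idPr sx).
rewrite (dimv_addline_notin xU) => dW.
apply/negP; rewrite memvE => /addv_idPl eX.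
by have := congr1 (fun Y => \dim Y) (etrans (esym eX) eW); lia.
Qed.

End VectorSpaces.

(** * Extremal numbers for propositional predicates, by classical logic *)

Lemma ex_max_nat (P : nat -> Prop) b : (exists n, P n) ->
  (forall n, P n -> (n <= b)%N) ->
  exists2 n, P n & forall m, P m -> (m <= n)%N.
Proof.
move=> exP leb; have exP' : exists n, `[<P n>].
  by have [n Pn] := exP; exists n; apply/asboolP.
have leb' n : `[<P n>] -> (n <= b)%N by move/asboolP; apply: leb.
case: (ex_maxnP exP' leb') => n /asboolP Pn max_n; exists n => // m Pm.
by apply: max_n; apply/asboolP.
Qed.

Lemma ex_min_nat (P : nat -> Prop) : (exists n, P n) ->
  exists2 n, P n & forall m, P m -> (n <= m)%N.
Proof.
move=> exP; have exP' : exists n, `[<P n>].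
  by have [n Pn] := exP; exists n; apply/asboolP.
case: (ex_minnP exP') => n /asboolP Pn min_n; exists n => // m Pm.
by apply: min_n; apply/asboolP.
Qed.

(** * The action of the algebra on subspaces, and a Nakayama lemma *)

Section Action.
Variables (C : numClosedFieldType) (n : nat) (A : {vspace 'M[C]_n}).
Hypothesis hA : is_nilpotent_algebra A.
Implicit Types (U V W F : {vspace 'cV[C]_n}) (X : 'M[C]_n) (x v : 'cV[C]_n).

Definition act U : {vspace 'cV[C]_n} :=
  (\sum_(i < \dim A) linfun (mulmx (vbasis A)`_i) @: U)%VS.

Lemma memv_act U X v : X \in A -> v \in U -> X *m v \in act U.
Proof.
move=> XA vU; rewrite (coord_vbasis XA) mulmx_suml memv_suml // => i _.
rewrite -scalemxAl memvZ //; apply: (subvP (sumv_sup i isT (subvv _))).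
by rewrite -[_ *m v](lfunE (mulmx _)) memv_img.
Qed.

Lemma act_subP U W :
  reflect {in A & U, forall X v, X *m v \in W} (act U <= W)%VS.
Proof.
apply: (iffP idP) => [sUW X v XA vU | sUW].
  exact: (subvP sUW) (memv_act XA vU).
apply/subv_sumP => i _; apply/subvP => _ /memv_imgP[v vU ->].
by rewrite lfunE /= sUW // vbasis_mem // mem_nth // size_tuple.
Qed.

Lemma invariantE U : invariant_subspace A U <-> (act U <= U)%VS.
Proof. by split=> /act_subP. Qed.

Lemma actS U W : (U <= W)%VS -> (act U <= act W)%VS.
Proof.
by move=> sUW; apply/act_subP => X v XA /(subvP sUW) vW; apply: memv_act.
Qed.

Lemma actD U W : act (U + W) = (act U + act W)%VS.
Proof. by rewrite /act -big_split; apply: eq_bigr => i _; rewrite limgD. Qed.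

Lemma act_act U : (act (act U) <= act U)%VS.
Proof.
have [mulA _] := hA; apply/act_subP => X v XA /memv_sumP[vs vsU ->].
rewrite mulmx_sumr memv_suml // => i _.
have /memv_imgP[u uU ->] := vsU i isT.
rewrite lfunE /= mulmxA memv_act // mulA // vbasis_mem // mem_nth //.
by rewrite size_tuple.
Qed.

(** On a line the coefficients merge into a single matrix of [A], so every nonzero vector of [act
    <[x]>] is a legal successor of [x] in a chain. *)
Lemma act_lineP x v :
  reflect (exists2 X, X \in A & v = X *m x) (v \in act <[x]>).
Proof.
apply: (iffP idP) => [/memv_sumP[vs vsP ->] | [X XA ->]]; last first.
  exact: memv_act XA (memv_line x).
have {vsP} /choice[c cP] i : exists c, vs i = c *: ((vbasis A)`_i *m x).
  have /memv_imgP[_ /vlineP[c ->] ->] := vsP i isT.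
  by exists c; rewrite lfunE /= scalemxAr.
exists (\sum_i c i *: (vbasis A)`_i).
  apply: memv_suml => i _; rewrite memvZ // vbasis_mem // mem_nth //.
  by rewrite size_tuple.
by rewrite mulmx_suml; apply: eq_bigr => i _; rewrite cP scalemxAl.
Qed.

Lemma act_sum (I : finType) (P : pred I) (S : I -> {vspace 'cV[C]_n}) :
  (forall i, act (S i) <= S i)%VS ->
  (act (\sum_(i | P i) S i) <= \sum_(i | P i) S i)%VS.
Proof.
move=> invS; apply/act_subP => X v XA /memv_sumP[vs vsS ->].
rewrite mulmx_sumr memv_suml // => i Pi.
apply: (subvP (sumv_sup i Pi (subvv _))).
exact: (subvP (invS i)) (memv_act XA (vsS i Pi)).
Qed.

(* If [Ax] generates [F] modulo [U] with [x] in [F], then [x = u + Xx] and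
   [1 - X] is invertible with an inverse preserving [U], so [x] is in [U]. *)
Lemma nakayama_proper U F : (act U <= U)%VS -> (act F <= F)%VS ->
  (U <= F)%VS -> ~~ (F <= U)%VS -> ~~ (F <= U + act F)%VS.
Proof.
have [d] := ubnP (\dim F - \dim U).
elim: d U => // d IHd U led invU invF sUF nFU.
have [/act_subP sFU | ] := boolP (act F <= U)%VS.
  by rewrite (addv_idPl _) //; apply/act_subP.
(* As [act F] is not inside [U], some [x] in [F] has [act <[x]>] not inside [U]; adding it to [U]
   lowers the codimension. *)
have [allx|] := pselect (forall x, x \in F -> (act <[x]> <= U)%VS).
  case/negP; apply/act_subP => X x XA /allx/subvP; apply.
  exact: memv_act (memv_line x).
move=> /existsNP[x /not_implyP[xF /negP nxU]] _.
pose N := (U + act <[x]>)%VS.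
have sxF : (act <[x]> <= act F)%VS by rewrite actS // -memvE.
have invN : (act N <= N)%VS by rewrite actD addvS // act_act.
have sNF : (N <= F)%VS by rewrite subv_add sUF (subv_trans sxF).
have sNFU : (N <= U + act F)%VS by rewrite addvS.
have [sFN | nFN] := boolP (F <= N)%VS; last first.
  have ltUN : (\dim U < \dim N)%N.
    have /leqifP := dimv_leqif_sup (addvSl U (act <[x]>)).
    by rewrite subv_add subvv /= (negPf nxU).
  have leNF := dimvS sNF.
  apply: contra (IHd N _ invN invF sNF nFN); last first.
    by move: led ltUN leNF; clear; lia.
  by move/subv_trans; apply; rewrite addvS // addvSl.
have /memv_addP[u uU [_ /act_lineP[X XA ->] ex]] := subvP sFN _ xF.
have [_ /(_ X XA)[k Xk0]] := hA.
(* Telescoping replaces the inverse of [1 - X]; at [j = k] only [x] remains. *)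
have xXU j : x - X ^+ j *m x \in U.
  elim: j => [|j IHj]; first by rewrite expr0 mul1mx subrr mem0v.
  rewrite exprS -mulmxA -[x in x - _](subrK (X *m x)) -addrA -mulmxBr.
  rewrite memvD //; first by rewrite {1}ex addrK.
  exact: (subvP invU) (memv_act XA IHj).
case/negP: nxU; apply: subv_trans invU; rewrite actS // -memvE.
by have := xXU k; rewrite Xk0 mul0mx subr0.
Qed.

Lemma nakayama U F : (act U <= U)%VS -> (act F <= F)%VS ->
  (U <= F)%VS -> (F <= U + act F)%VS -> (F <= U)%VS.
Proof.
move=> invU invF sUF; apply: contraLR; exact: nakayama_proper.
Qed.

Lemma nakayama0 F : (act F <= F)%VS -> (F <= act F)%VS -> F = 0%VS.
Proof.
move=> invF sF; apply/eqP; rewrite -subv0.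
have act0 : (act 0 <= 0)%VS.
  by apply/act_subP => X v _; rewrite memv0 => /eqP->; rewrite mulmx0 mem0v.
by apply: (nakayama act0 invF); rewrite ?sub0v ?add0v.
Qed.

End Action.

(** * Slots and the Rado condition *)

Section Slots.
Variables (C : numClosedFieldType) (n : nat) (A : {vspace 'M[C]_n}).
Hypothesis hA : is_nilpotent_algebra A.
Variable m : nat.
Implicit Types (F U V W : {vspace 'cV[C]_n}) (S : 'I_m -> {vspace 'cV[C]_n}).
Implicit Types (i j k l : 'I_m) (J : {set 'I_m}).

Notation act := (act A).

Definition slots S J : {vspace 'cV[C]_n} := (\sum_(j in J) S j)%VS.

Definition reach S U J := (act U + slots S J)%VS.

Definition rado F S := forall U J, (U <= F)%VS ->
  (\dim U + #|J| <= \dim (reach S U J) + m)%N.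

(** Only the inequality reverse to [rado] is recorded; together they give equality. *)
Definition tight F S U J :=
  (U <= F)%VS /\ (\dim (reach S U J) + m <= \dim U + #|J|)%N.

(* The empty list is allowed: a slot may remain unused. *)
Fixpoint chain_from W (c : seq 'cV[C]_n) : Prop :=
  if c is x :: c' then x \in W /\ chain_from (act <[x]>) c' else True.

Lemma slotsS S J J' : J \subset J' -> (slots S J <= slots S J')%VS.
Proof.
by move/subsetP=> sJ; apply/subv_sumP => j /sJ jJ'; apply: (sumv_sup j).
Qed.

Lemma slots_sup S J j : j \in J -> (S j <= slots S J)%VS.
Proof. by move=> jJ; apply: (sumv_sup j). Qed.

Lemma slotsU S J J' : slots S (J :|: J') = (slots S J + slots S J')%VS.
Proof.
apply: subv_anti; rewrite subv_add !slotsS ?subsetUl ?subsetUr // !andbT.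
apply/subv_sumP => j /setUP[] jJ; last rewrite addvC;
  by apply: subv_trans (addvSl _ _); apply: slots_sup.
Qed.

Lemma eq_slots S S' J : {in J, S =1 S'} -> slots S J = slots S' J.
Proof. by move=> eS; apply: eq_bigr. Qed.

Lemma slotsD1 S J i : i \in J -> slots S J = (S i + slots S (J :\ i))%VS.
Proof.
move=> iJ; rewrite /slots (bigD1 i) //=; congr (_ + _)%VS.
by apply: eq_bigl => j; rewrite !inE andbC.
Qed.

Lemma reachS S U U' J J' : (U <= U')%VS -> J \subset J' ->
  (reach S U J <= reach S U' J')%VS.
Proof. by move=> sU sJ; rewrite addvS ?actS ?slotsS. Qed.

Lemma reachU S U U' J J' :
  reach S (U + U') (J :|: J') = (reach S U J + reach S U' J')%VS.
Proof. by rewrite /reach actD slotsU Monoid.mulmACA. Qed.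

(** Uncrossing: [rado] at the intersections bounds the common part of the two reaches from below,
    which leaves no slack for the join. *)
Lemma tightU F S U U' J J' : rado F S -> tight F S U J -> tight F S U' J' ->
  tight F S (U + U') (J :|: J').
Proof.
move=> radoS [sU tU] [sU' tU']; split; first by rewrite subv_add sU.
have sUI : (U :&: U' <= F)%VS by rewrite (subv_trans (capvSl _ _)).
have := radoS _ (J :&: J') sUI.
have := dimv_sum_cap (reach S U J) (reach S U' J').
have : (reach S (U :&: U') (J :&: J') <= reach S U J :&: reach S U' J')%VS.
  by rewrite subv_cap !reachS ?capvSl ?capvSr ?subsetIl ?subsetIr.
move/dimvS; rewrite -reachU.
have := dimv_sum_cap U U'; have := cardsUI J J'.
by lia.
Qed.

(** By submodularity a slot gains no more over [W] plus other slots than over [W] alone. *)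
Lemma dimv_add_slots S W J : (forall j, j \in J ->
    \dim (W + S j) <= \dim W + 1)%N ->
  (\dim (W + slots S J) <= \dim W + #|J|)%N.
Proof.
move=> leS; rewrite /slots -sum1_card.
elim/big_rec2: _ => [|j d V jJ IH]; first by rewrite addv0 addn0.
have := dimv_add_codim (S j) (addvSl W V); have := leS j jJ.
by rewrite -addvA (addvC V); lia.
Qed.

(** * Blocking pairs and a coloop for slots that cannot shrink *)

Section Irreducible.
Variables (F : {vspace 'cV[C]_n}) (S : 'I_m -> {vspace 'cV[C]_n}).
Hypotheses (invF : (act F <= F)%VS) (sSF : forall j, (S j <= F)%VS).
Hypotheses (invS : forall j, (act (S j) <= S j)%VS) (radoS : rado F S).

(** By invariance [U + Q] reaches no further than [Q], so [rado] at [U + Q] and tightness at [U]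
    give both the same dimension. *)
Lemma tight_reach U J : tight F S U J -> (reach S U J <= U)%VS.
Proof.
move=> [sU]; set Q := reach S U J => tU.
have sQF : (Q <= F)%VS.
  rewrite subv_add (subv_trans (actS A sU)) //=.
  by apply/subv_sumP => j _; apply: sSF.
have sUQ : (U + Q <= F)%VS by rewrite subv_add sU.
have sQQ : (reach S (U + Q) J <= Q)%VS.
  rewrite /Q /reach !actD !subv_add addvSl addvSr /= andbT.
  apply/andP; split; first exact: subv_trans (act_act hA U) (addvSl _ _).
  exact: subv_trans (act_sum _ invS) (addvSr _ _).
apply: subv_of_dim; move: (radoS J sUQ) (dimvS sQQ) tU; clear; lia.
Qed.

(* The last condition is there because [k] is a coloop only if every slot
   outside [J] adds at most one dimension to [reach S F J]. *)
Definition blocking i U J :=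
  [/\ tight F S U J, i \notin J, (S i <= U)%VS
    & (\dim (reach S U J + S i) <= \dim (reach S U J) + 1)%N].

Lemma blockingU i U J U' J' : blocking i U J -> tight F S U' J' ->
  i \notin J' -> blocking i (U + U') (J :|: J').
Proof.
move=> [tU iJ sU dQ] tU' iJ'; split; first exact: tightU.
- by rewrite inE negb_or iJ.
- by rewrite (subv_trans sU) ?addvSl.
have sQ : (reach S U J <= reach S (U + U') (J :|: J'))%VS.
  by rewrite reachS ?addvSl ?subsetUl.
by have := dimv_add_codim (S i) sQ; lia.
Qed.

Definition shrink i W j := if j == i then W else S j.

Hypothesis irreducible : forall i W, (act W <= W)%VS -> (W <= S i)%VS ->
  (\dim W < \dim (S i))%N -> ~ rado F (shrink i W).

(** Shrinking [S i] to a hyperplane [W] containing [act (S i)] violates [rado] at some [(U, J)];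
    then [(U, J :\ i)] blocks [i]. *)
Lemma exists_blocking i : S i != 0%VS -> exists U J, blocking i U J.
Proof.
move=> Si0.
have nS : ~~ (S i <= act (S i))%VS.
  by apply: contra Si0 => sS; rewrite (nakayama0 hA (invS i) sS).
have [W [x [sW eS xW]]] := exists_hyperplane (invS i) nS.
have sWS : (W <= S i)%VS by rewrite -eS addvSl.
have dS : \dim (S i) = (\dim W).+1 by rewrite -eS dimv_addline_notin.
have invW : (act W <= W)%VS by rewrite (subv_trans _ sW) ?actS.
have ltW : (\dim W < \dim (S i))%N by rewrite dS.
have := irreducible invW sWS ltW.
move=> /existsNP[U] /existsNP[J] /not_implyP[sU /negP].
rewrite -ltnNge => lt_m.
have iJ : i \in J.
  apply: contraLR lt_m => iJ; rewrite -leqNgt.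
  rewrite /reach (@eq_slots _ S) ?radoS // => j jJ.
  by rewrite /shrink; case: eqP jJ iJ => // -> ->.
pose J0 := J :\ i; have cJ : #|J| = #|J0|.+1 by rewrite (cardsD1 i J) iJ.
have eR : reach (shrink i W) U J = (reach S U J0 + W)%VS.
  rewrite /reach (slotsD1 _ iJ) {1}/shrink eqxx (addvC W) addvA.
  congr (_ + _ + _)%VS; apply: eq_slots => j.
  by rewrite !inE /shrink => /andP[/negPf->].
set Q := reach S U J0 in eR; rewrite eR cJ in lt_m.
(* The violation at [J] and [rado] at [J0] leave [W] no room to enlarge [Q]. *)
have sWQ : (W <= Q)%VS.
  apply: subv_of_dim; move: (radoS J0 sU) lt_m; rewrite -/Q; clear; lia.
rewrite (addv_idPl sWQ) in lt_m.
exists U, J0; split; first by split=> //; move: lt_m; rewrite -/Q; clear; lia.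
- by rewrite !inE eqxx.
(* Since [act (S i)] lies in [W], hence in [Q], adding [S i] to [U] does not enlarge the reach. *)
- have sUS : (U + S i <= F)%VS by rewrite subv_add sU sSF.
  have sR : (reach S (U + S i) J0 <= Q)%VS.
    rewrite /reach actD !subv_add addvSl addvSr /= andbT.
    exact: subv_trans sW sWQ.
  apply: subv_of_dim; move: (radoS J0 sUS) (dimvS sR) lt_m; clear; lia.
by rewrite -/Q -eS addvA (addv_idPl sWQ) dimv_addline.
Qed.

(** Among slots not inside [act F], choose [k] and a blocking pair [(U, J)] with [\dim U + #|J|]
    maximal. Maximality and Nakayama force [U = F], and a dimension count does the rest. *)
Lemma exists_coloop : F != 0%VS ->
  exists2 k, ~~ (S k <= reach S F [set~ k])%VS &
    \dim F = (\dim (reach S F [set~ k])).+1.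
Proof.
move=> F0.
have gen : (F <= reach S F setT)%VS.
  have := radoS setT (subvv F); rewrite cardsT card_ord leq_add2r => le.
  have sF : (reach S F setT <= F)%VS.
    by rewrite subv_add invF /=; apply/subv_sumP => j _; apply: sSF.
  by have [_ /esym] := dimv_leqif_sup sF; rewrite eqn_leq le dimvS.
have S0 i : ~~ (S i <= act F)%VS -> S i != 0%VS.
  by apply: contra => /eqP->; apply: sub0v.
have [k0 k0P] : exists k, ~~ (S k <= act F)%VS.
  apply/not_existsP => sS; case/negP: F0; apply/eqP.
  apply: (nakayama0 hA invF); apply: subv_trans gen _.
  rewrite subv_add subvv /=; apply/subv_sumP => j _.
  by apply/negPn/negP/sS.
pose P d := exists k U J,
  [/\ ~~ (S k <= act F)%VS, blocking k U J & d = (\dim U + #|J|)%N].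
have exP : exists d, P d.
  have [U [J bU]] := exists_blocking (S0 _ k0P).
  by exists (\dim U + #|J|)%N, k0, U, J.
have leP d : P d -> (d <= \dim F + m)%N.
  move=> [k [U [J [_ [[sU _] _ _ _] ->]]]].
  by rewrite leq_add ?dimvS // -[m in leqRHS]card_ord max_card.
have [_ [k [U [J [kP bU ->]]]] maxU] := ex_max_nat exP leP.
have [tU kJ sU dQ] := bU.
(* Joining a pair that blocks [l] to [(U, J)] cannot exceed the maximum, so the join is [(U, J)]
   itself. *)
have bl l : ~~ (S l <= act F)%VS -> l \notin J -> blocking l U J.
  move=> lP lJ; have [Ul [Jl bUl]] := exists_blocking (S0 _ lP).
  have bUU := blockingU bUl tU lJ.
  have /maxU le : P (\dim (Ul + U) + #|Jl :|: J|)%N.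
    by exists l, (Ul + U)%VS, (Jl :|: J).
  have sUU := addvSr Ul U; have sJJ := subsetUr Jl J.
  have eU : (Ul + U)%VS = U.
    apply/eqP; rewrite eq_sym eqEdim sUU /= -(leq_add2r #|J|).
    by rewrite (leq_trans _ le) // leq_add2l subset_leq_card.
  have eJ : Jl :|: J = J.
    apply/eqP; rewrite eq_sym eqEcard sJJ /= -(leq_add2l (\dim U)).
    by rewrite (leq_trans _ le) // leq_add2r dimvS.
  by rewrite eU eJ in bUU.
have sQU := tight_reach tU.
(* Every slot lies in [U + act F], so [U] generates [F] modulo [act F]. *)
have eUF : U = F.
  have [sUF _] := tU; apply: subv_anti; rewrite sUF /=.
  apply: (nakayama hA _ invF sUF).
    by apply: subv_trans sQU; apply: addvSl.
  apply: subv_trans gen _; rewrite subv_add addvSr /=.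
  apply/subv_sumP => j _.
  have [sj | nj] := boolP (S j <= act F)%VS.
    by rewrite (subv_trans sj) ?addvSr.
  apply: subv_trans (addvSl _ _).
  have [jJ | jJ] := boolP (j \in J); last by have [] := bl j nj jJ.
  by apply: subv_trans sQU; apply: subv_trans (addvSr _ _); apply: slots_sup.
rewrite {}eUF in tU bl dQ sQU {bU maxU sU}.
set H := reach S F [set~ k].
set Q := reach S F J in dQ.
have sQH : (Q <= H)%VS.
  rewrite reachS //; apply/subsetP => j jJ; rewrite !inE.
  by apply: contraNneq kJ => <-.
have eHk : (H + S k)%VS = reach S F setT.
  by rewrite /reach (slotsD1 S (in_setT k)) setTD -!addvA (addvC _ (S k)).
(* [S k] gains at most one dimension over [Q], hence over [H], and [H + S k] contains [F]. *)
have le1 : (\dim F <= \dim H + 1)%N.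
  have := dimv_add_codim (S k) sQH; rewrite eHk.
  by move: dQ (dimvS gen); clear; lia.
have sHQ : (H <= Q + slots S (~: J :\ k))%VS.
  rewrite subv_add (subv_trans (addvSl (act F) (slots S J))) ?addvSl //=.
  apply/subv_sumP => j; rewrite !inE => jk.
  have [jJ | jJ] := boolP (j \in J).
    apply: subv_trans (addvSl _ _); apply: subv_trans (addvSr _ _).
    exact: slots_sup.
  by apply: subv_trans (addvSr _ _); apply: slots_sup; rewrite !inE jk.
(* The slots outside [J] other than [k] number [m - #|J| - 1] and gain at most one dimension each;
   tightness then keeps [H] smaller than [F]. *)
have le2 : (\dim (Q + slots S (~: J :\ k)) <= \dim Q + #|~: J :\ k|)%N.
  apply: dimv_add_slots => j; rewrite !inE => /andP[_ jJ].
  have [sj | nj] := boolP (S j <= act F)%VS; last by have [] := bl j nj jJ.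
  by rewrite (addv_idPl _) ?leq_addr // (subv_trans sj) ?addvSl.
have dF : \dim F = (\dim H).+1.
  have [_] := tU; rewrite -/Q => tQ; rewrite addn1 in le1; apply/eqP.
  rewrite eqn_leq le1 /=.
  have cJ : (#|J| + #|~: J :\ k|.+1 = m)%N.
    have := cardsD1 k (~: J); rewrite inE kJ add1n => <-.
    by rewrite cardsC card_ord.
  by move: le2 tQ (dimvS sHQ) cJ; clear; lia.
exists k => //; rewrite -/H; apply/negP => /addv_idPl eH.
by move: (dimvS gen); rewrite -eHk eH dF ltnn.
Qed.

End Irreducible.

(** * Construction of the chains *)

Lemma perm_flatten_cons (T : eqType) (c c' : 'I_m -> seq T) k x :
  c' k = x :: c k -> (forall j, j != k -> c' j = c j) ->
  perm_eq (flatten (codom c')) (x :: flatten (codom c)).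
Proof.
move=> ek ej; apply/allP => y _ /=; apply/eqP.
rewrite !count_flatten -!map_comp !sumnE !big_map.
rewrite (bigD1 k) // [in RHS](bigD1 k) //= ek /=.
by rewrite addnA; congr (_ + _)%N; apply: eq_bigr => j /ej->.
Qed.

(** The induction measure [\dim F + \sum_j \dim (S j)] drops both when a slot shrinks and when [F]
    gives way to a hyperplane. *)
Lemma rado_chains F S : (act F <= F)%VS -> (forall j, (S j <= F)%VS) ->
  (forall j, (act (S j) <= S j)%VS) -> rado F S ->
  exists2 c : 'I_m -> seq 'cV[C]_n,
    forall j, chain_from (S j) (c j) & basis_of F (flatten (codom c)).
Proof.
have [d] := ubnP (\dim F + \sum_j \dim (S j)).
elim: d F S => // d IHd F S led invF sSF invS radoS.
have [F0 | nF0] := eqVneq F 0%VS.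
  exists (fun=> [::]) => //.
  have -> : flatten (codom (fun _ : 'I_m => [::])) = [::] :> seq 'cV[C]_n.
    by rewrite /codom /image_mem; elim: (enum _).
  by rewrite F0 basisEdim sub0v dimv0.
have [[i [W [invW sWS ltW radoW]]] | irr] := pselect (exists i W,
    [/\ (act W <= W)%VS, (W <= S i)%VS, (\dim W < \dim (S i))%N
      & rado F (shrink S i W)]).
  have [] := IHd F (shrink S i W) _ invF _ _ radoW.
  - have lt_sum : (\sum_j \dim (shrink S i W j) < \sum_j \dim (S j))%N.
      rewrite (bigD1 i) // [in ltnRHS](bigD1 i) //= /shrink eqxx -addSn.
      by rewrite leq_add // leq_sum // => j /negPf->.
    by move: led lt_sum; clear; lia.
  - by move=> j; rewrite /shrink; case: eqP => // _; apply: subv_trans sWS _.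
  - by move=> j; rewrite /shrink; case: eqP.
  move=> c cS bc; exists c => // j; move: (cS j); rewrite /shrink.
  case: eqP => // ->; case: (c i) => //= x s [xW ?].
  by split=> //; apply: (subvP sWS).
have irreducible i W : (act W <= W)%VS -> (W <= S i)%VS ->
  (\dim W < \dim (S i))%N -> ~ rado F (shrink S i W).
  by move=> ? ? ? ?; apply: irr; exists i, W.
have [k /subvPn[h hS hH] dH] :=
  exists_coloop invF sSF invS radoS irreducible nF0.
set H := reach S F [set~ k] in hH dH.
have sHF : (H <= F)%VS.
  by rewrite subv_add invF /=; apply/subv_sumP => j _; apply: sSF.
have sSH j : j != k -> (S j <= H)%VS.
  move=> jk; apply: subv_trans (addvSr _ _).
  by apply: slots_sup; rewrite !inE.
have invH : (act H <= H)%VS by rewrite (subv_trans (actS A sHF)) ?addvSl.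
have h0 : h != 0 by apply: contraNneq hH => ->; apply: mem0v.
have eF : (H + <[h]>)%VS = F.
  apply/eqP; rewrite eqEdim subv_add sHF -memvE (subvP (sSF k)) //=.
  by rewrite dimv_addline_notin // dH.
have shS : (act <[h]> <= S k)%VS.
  by apply: subv_trans (invS k); rewrite actS // -memvE.
have [] := IHd H (shrink S k (act <[h]>)) _ invH _ _ _.
- have : (\sum_j \dim (shrink S k (act <[h]>) j) <= \sum_j \dim (S j))%N.
    by apply: leq_sum => j _; apply: dimvS; rewrite /shrink; case: eqP => // ->.
  by move: led dH; clear; lia.
- move=> j; rewrite /shrink; case: eqP => [_ | /eqP]; last exact: sSH.
  by apply: subv_trans (addvSl _ _); rewrite actS // -eF addvSr.
- by move=> j; rewrite /shrink; case: eqP => // _; apply: act_act.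
- move=> U J sUH; have sUF := subv_trans sUH sHF.
  have [kJ | kJ] := boolP (k \in J); last first.
    rewrite /reach (@eq_slots _ S) ?radoS // => j jJ.
    by rewrite /shrink; case: eqP jJ kJ => // -> ->.
  (* Moving [h] from the slot into the subspace trades [k] in [J] for one dimension of [U], so the
     old condition carries over. *)
  have -> : reach (shrink S k (act <[h]>)) U J =
            reach S (U + <[h]>) (J :\ k).
    rewrite /reach (slotsD1 _ kJ) {1}/shrink eqxx actD addvA.
    congr (_ + _)%VS; apply: eq_slots => j.
    by rewrite !inE /shrink => /andP[/negPf->].
  have sUhF : (U + <[h]> <= F)%VS by rewrite -eF addvS.
  have hU : h \notin U by apply: contra hH; apply: (subvP sUH).
  have := radoS _ (J :\ k) sUhF; rewrite dimv_addline_notin //.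
  by rewrite (cardsD1 k J) kJ addnS.
move=> c cS bc; exists (fun j => if j == k then h :: c k else c j).
  move=> j; have := cS j; rewrite /shrink; case: eqP => // ->.
  by case: (c k).
rewrite (@perm_basis _ _ _ (h :: flatten (codom c))); last first.
  by apply: (@perm_flatten_cons _ c _ k); rewrite ?eqxx // => j /negPf->.
rewrite -eF addvC -cat1s cat_basis ?seq1_basis //.
apply/directv_addP/eqP; rewrite -dimv_eq0.
have := dimv_sum_cap H <[h]>; rewrite dimv_addline_notin // dim_vline h0 capvC.
by clear; lia.
Qed.

Lemma chain_from_quantum W c : chain_from W c -> c != [::] -> 0 \notin c ->
  quantum_chain A c.
Proof.
move=> cW c0 nc0; split=> // i; elim: c W i {c0 nc0} cW => //= x c IHc W i.
case: c IHc => // y c IHc [_ cW]; case: i => [_ | i]; last exact: IHc cW.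
by have [/act_lineP[X XA ->] _] := cW; exists X.
Qed.

End Slots.

(** * Orthogonal complements and projections *)

Section Orthogonality.
Variables (C : numClosedFieldType) (n : nat).
Implicit Types (U V W E : {vspace 'cV[C]_n}).

Lemma cdot_eq0 (v : 'cV[C]_n) : cdot v v = 0 -> v = 0.
Proof.
rewrite cdotE => /eqP; rewrite psumr_eq0 => [/allP v0 | i _]; last first.
  exact: mul_conjC_ge0.
apply/colP => i; rewrite mxE; apply/eqP; rewrite -mul_conjC_eq0.
by apply: v0; rewrite mem_index_enum.
Qed.

Lemma capv_orthoc W : (W :&: orthoc W)%VS = 0%VS.
Proof.
apply/eqP; rewrite -subv0; apply/subvP => v /memv_capP[vW /orthocP vo].
by rewrite memv0; apply/eqP/cdot_eq0/vo.
Qed.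

(** Each vector of a basis of [W] imposes one linear condition on [U]. *)
Lemma dim_cap_orthoc U W : (\dim U <= \dim (U :&: orthoc W) + \dim W)%N.
Proof.
have [s] : {s : seq 'cV[C]_n | size s = \dim W /\ <<s>>%VS = W}.
  by exists (vbasis W); rewrite size_tuple (span_basis (vbasisP W)).
move=> [<- <-] {W}; elim: s U => [|x s IHs] U.
  by rewrite span_nil /orthoc orthov0 capvf leq_addr.
have := leq_dim_orthov1 (@cdot C n) x U.
have := IHs (U :&: orthoc <[x]>)%VS; rewrite /orthoc.
have : (U :&: orthov (@cdot C n) <[x]> :&: orthov (@cdot C n) <<s>> <=
        U :&: orthov (@cdot C n) <<x :: s>>)%VS.
  by rewrite -capvA capvS // span_cons orthovD capvSl capvSr.
move/dimvS => leb lea led; rewrite /= addnS (leq_trans (leqSpred _)) // ltnS.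
by apply: leq_trans led _; apply: leq_trans lea _; rewrite leq_add2r.
Qed.

Lemma addv_orthoc W : (W + orthoc W)%VS = fullv.
Proof.
apply/eqP; rewrite eqEdim subvf /= dimv_disjoint_sum ?capv_orthoc //.
by have := dim_cap_orthoc fullv W; rewrite capfv addnC.
Qed.

(** The projection onto [W] along [orthoc W], written in the standard basis. *)
Lemma exists_orthoproj W : exists P, is_orthoproj P W.
Proof.
pose f := daddv_pi W (orthoc W).
exists (\matrix_(i, j) f (delta_mx j 0) i 0) => v.
have -> : (\matrix_(i, j) f (delta_mx j 0) i 0) *m v = f v.
  apply/colP => i; rewrite mxE [v in RHS]matrix_sum_delta linear_sum summxE.
  apply: eq_bigr => j _.
  by rewrite big_ord1 linearZ !mxE mulrC.
have dW := capv_orthoc W.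
have vD : v \in (W + orthoc W)%VS by rewrite addv_orthoc memvf.
split; first exact: memv_pi.
by rewrite -{1}(daddv_pi_add dW vD) addrAC subrr add0r memv_pi.
Qed.

End Orthogonality.

(** * Antichains, the deficiency bound and the resulting partition *)

Section Width.
Variables (C : numClosedFieldType) (n : nat) (A : {vspace 'M[C]_n}).
Hypothesis hA : is_nilpotent_algebra A.

(** [A] sends [E] into [act A U], which is orthogonal to [E] and so killed by the projection. *)
Lemma antichain_of U : let E := ((U + act A U) :&: orthoc (act A U))%VS in
  E != 0%VS -> quantum_antichain A E.
Proof.
move=> E E0; set W := act A U in E E0 *.
have invW : (act A W <= W)%VS by apply: act_act.
split=> //.
  exists (U + W)%VS, W; split=> //; last exact: addvSr.
    by apply/invariantE; rewrite actD subv_add addvSr (subv_trans invW) ?addvSr.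
  exact/invariantE.
have [P PE] := exists_orthoproj E; exists P => // X XA.
have sWE : (W <= orthoc E)%VS by rewrite /orthoc orthov_sym capvSr.
have PW v : v \in W -> P *m v = 0.
  move=> vW; have [PvE Pvo] := PE v; apply/eqP.
  rewrite -memv0 -(capv_orthoc E) memv_cap PvE /=.
  by rewrite -[P *m v](subKr v) memvB // (subvP sWE).
apply/matrixP => i j.
have : P *m (X *m (P *m delta_mx j 0)) = 0 :> 'cV[C]_n.
  apply: PW; have [/memv_capP[PvU _] _] := PE (delta_mx j 0).
  apply: subvP (memv_act XA PvU).
  by rewrite actD subv_add subvv.
by rewrite !mulmxA -colE => /colP/(_ i); rewrite mxE => ->; rewrite !mxE.
Qed.

Lemma width_bound w : (forall E, quantum_antichain A E -> (\dim E <= w)%N) ->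
  forall U, (\dim U <= \dim (act A U) + w)%N.
Proof.
move=> lew U; pose E := ((U + act A U) :&: orthoc (act A U))%VS.
have le1 : (\dim U <= \dim E + \dim (act A U))%N.
  by apply: leq_trans (dim_cap_orthoc _ _); apply/dimvS/addvSl.
have [E0 | /antichain_of/lew] := eqVneq E 0%VS.
  by rewrite (leq_trans le1) // E0 dimv0 leq_addr.
by move: le1; rewrite -/E; clear; lia.
Qed.

(** By Nakayama [act A fullv] is proper, so its orthogonal complement is nonzero. This makes the
    maximal width exist. *)
Lemma exists_antichain : (0 < n)%N -> exists E, quantum_antichain A E.
Proof.
move=> n_gt0; exists ((fullv + act A fullv) :&: orthoc (act A fullv))%VS.
apply: antichain_of; rewrite (addv_idPl (subvf _)) capfv.
apply/eqP => o0; have := addv_orthoc (act A fullv); rewrite o0 addv0 => e.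
have := nakayama0 hA (subvf _).
rewrite e => /(_ (subvv _))/(congr1 (@dimv _ _)).
by rewrite dimvf dimv0 /dim /= muln1 => n0; rewrite n0 in n_gt0.
Qed.

Lemma exists_chain_partition w :
  (forall E, quantum_antichain A E -> (\dim E <= w)%N) ->
  exists2 p, quantum_chain_partition A p & (size p <= w)%N.
Proof.
move=> lew; have radoV : rado A fullv (fun _ : 'I_w => fullv).
  move=> U J _; have [-> | /set0Pn[j jJ]] := eqVneq J set0.
    by rewrite cards0 addn0 /reach /slots big_set0 addv0 width_bound.
  have -> : reach A (fun _ : 'I_w => fullv) U J = fullv.
    apply: subv_anti; rewrite subvf /=; apply: subv_trans (addvSr _ _).
    exact: (@slots_sup _ _ _ (fun=> fullv) _ _ jJ).
  by rewrite leq_add ?dimvS ?subvf // -[leqRHS]card_ord max_card.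
have [c cV bc] := rado_chains hA (subvf _) (fun=> subvf _) (fun=> subvf _) radoV.
have flat0 (ss : seq (seq 'cV[C]_n)) :
    flatten [seq s <- ss | s != [::]] = flatten ss.
  by elim: ss => //= -[|x s] ss /= ->.
exists [seq s <- codom c | s != [::]]; last first.
  by rewrite size_filter (leq_trans (count_size _ _)) // size_codom card_ord.
split; last by rewrite flat0.
move=> s; rewrite mem_filter => /andP[s0 sc].
have /codomP[j ej] := sc.
apply: (@chain_from_quantum _ _ A fullv) => //; first by rewrite ej; apply: cV.
apply/negP => s_0; have f0 : 0 \in flatten (codom c).
  by apply/flattenP; exists s.
by have := basis_not0 bc f0; rewrite eqxx.
Qed.

End Width.

Theorem theorem6p8 (R : realType) (n : nat) (hn : (0 < n)%N)
    (A : {vspace 'M[R[i]]_n}) (hA : is_nilpotent_algebra A) :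
  exists k w : nat,
    [/\ is_min_partition_size A k, is_max_antichain_width A w & (k <= w)%N].
Proof.
pose width d := exists2 E, quantum_antichain A E & \dim E = d.
have [||w ww maxw] := @ex_max_nat width n.
- by have [E aE] := exists_antichain hA hn; exists (\dim E), E.
- move=> _ [E _ <-]; apply: leq_trans (dimvS (subvf E)) _.
  by rewrite dimvf /dim /= muln1.
have lew E : quantum_antichain A E -> (\dim E <= w)%N.
  by move=> aE; apply: maxw; exists E.
have [p pP lep] := exists_chain_partition hA lew.
pose psize d := exists2 p, quantum_chain_partition A p & size p = d.
have [|k pk mink] := @ex_min_nat psize; first by exists (size p), p.
exists k, w; split=> //.
- by split=> // q qP; apply: mink; exists q.
- by apply: leq_trans lep; apply: mink; exists p.
Qed.
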